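(* Let $N\ge 2$ be an integer and let $p>N+1$ be a prime number. Then the algebraic homology $H^{\mathrm{alg}}_{p}(\mathit{sl}_N,\mathbb{Z})$, i.e. the homology of the Koszul complex $(\mathcal{H}_p,d_N)$ over $\mathbb{Z}$, has $p$-torsion in bidegree $q^{2p+2N+2}t^{2p+1}$.
   Context: For $n\ge 1$, $\mathcal{H}_n$ is the free supercommutative algebra (here over $\mathbb{Z}$) with even generators $x_0,\ldots,x_{n-1}$ and odd generators $\xi_0,\ldots,\xi_{n-1}$, bigraded by $$\deg x_k=q^{2k+2}t^{2k},\qquad \deg \xi_k=q^{2N+2k}t^{2k+1},$$ where a monomial $q^{\alpha}t^{\beta}$ means $q$-degree $\alpha$ and $t$-degree $\beta$, and degrees are additive under multiplication. The Koszul differential $d_N$ is the odd derivation determined by $$d_N(x_k)=0,\qquad d_N(\xi_k)=\sum_{i_1+\cdots+i_N=k}x_{i_1}\cdots x_{i_N},$$ the sum being over ordered $N$-tuples of non-negative integers. It preserves the $q$-grading and decreases the $t$-grading by $1$. The homology of $d_N$ acting on $\mathcal{H}_n$ is denoted $H^{\mathrm{alg}}_n(\mathit{sl}_N)$, and $H^{\mathrm{alg}}_n(\mathit{sl}_N,\mathbb{Z})$ when the coefficients are $\mathbb{Z}$.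
   Formalization: The torsion is stated in bidegree q^{2p+2N+2}t^{2p} instead of q^{2p+2N+2}t^{2p+1}: with the given gradings and t-lowering d_N there are no nonzero boundaries in t-degree 2p+1, so the homology there is torsion-free; 2p+1 is the degree of the bounding chain. *)

(* Defs.v *)
From HB Require Import structures.
From mathcomp Require Import all_boot all_order all_algebra.
From mathcomp Require Import boolp.
From mathcomp Require Import mpoly.
From mathcomp Require Import ring.

Set Implicit Arguments.
Unset Strict Implicit.
Unset Printing Implicit Defensive.

Import GRing.Theory.
Import Quotient.Exports.

Local Open Scope ring_scope.

(* f : ext R n stands for the sum over S of f S times the product of the
   xi_k, k in S, taken in increasing order; this is ext_decomp below. *)
Definition ext (R : comNzRingType) (n : nat) := {ffun {set 'I_n} -> R}.

HB.instance Definition _ (R : comNzRingType) (n : nat) :=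
  GRing.Zmodule.on (ext R n).

(* Number of transpositions needed to sort the product of the xi_i, i in S,
   followed by the product of the xi_j, j in T. *)
Definition shuffle (n : nat) (S T : {set 'I_n}) : nat :=
  \sum_(i in S) \sum_(j in T) (j < i)%N.

Section Shuffle.
Variable n : nat.
Implicit Types (S T U : {set 'I_n}) (k : 'I_n).

Lemma shuffle0l T : shuffle set0 T = 0%N.
Proof. by rewrite /shuffle big_set0. Qed.

Lemma shuffle0r S : shuffle S set0 = 0%N.
Proof. by rewrite /shuffle big1 // => i _; rewrite big_set0. Qed.

Lemma shuffleDl S T U : S \subset T ->
  shuffle T U = (shuffle S U + shuffle (T :\: S) U)%N.
Proof. by move=> /setIidPr sST; rewrite /shuffle (big_setID S) /= sST. Qed.

Lemma shuffleDr S T U : S \subset T ->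
  shuffle U T = (shuffle U S + shuffle U (T :\: S))%N.
Proof.
move=> /setIidPr sST; rewrite /shuffle -big_split; apply: eq_bigr => i _ /=.
by rewrite (big_setID S) /= sST.
Qed.

Lemma shuffle1C k S : k \notin S ->
  (shuffle [set k] S + shuffle S [set k])%N = #|S|.
Proof.
move=> kS; rewrite /shuffle big_set1 -big_split /= -sum1_card.
apply: eq_bigr => i iS; rewrite big_set1.
have : i != k by apply: contraNneq kS => <-.
by rewrite -val_eqE /=; case: ltngtP.
Qed.

End Shuffle.

Section ExtRing.
Variables (R : comNzRingType) (n : nat).
Implicit Types (f g h : ext R n) (S T U W : {set 'I_n}) (k : 'I_n).

Definition ext_one : ext R n := [ffun S : {set 'I_n} => (S == set0)%:R].

Definition ext_mul f g : ext R n :=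
  [ffun U : {set 'I_n} => \sum_(S : {set 'I_n} | S \subset U)
     (-1) ^+ shuffle S (U :\: S) * (f S * g (U :\: S))].

Lemma extP f g : (forall S : {set 'I_n}, f S = g S) -> f = g.
Proof. by move=> fg; apply/ffunP. Qed.

Lemma extD f g S : (f + g) S = f S + g S. Proof. by rewrite ffunE. Qed.

Fact ext_mulA : associative ext_mul.
Proof.
move=> f g h; apply: extP => U; rewrite [LHS]ffunE [RHS]ffunE.
transitivity (\sum_(S : {set 'I_n} | S \subset U)
  \sum_(T : {set 'I_n} | T \subset U :\: S)
   (-1) ^+ (shuffle S (U :\: S) + shuffle T (U :\: S :\: T)) *
     (f S * g T * h (U :\: S :\: T))).
  apply: eq_bigr => S SU; rewrite ffunE !mulr_sumr; apply: eq_bigr => T _.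
  by rewrite exprD -!mulrA; congr (_ * _); rewrite mulrCA.
transitivity (\sum_(W : {set 'I_n} | W \subset U)
  \sum_(S : {set 'I_n} | S \subset W)
   (-1) ^+ (shuffle W (U :\: W) + shuffle S (W :\: S)) *
     (f S * g (W :\: S) * h (U :\: W))); last first.
  apply: eq_bigr => S SU; rewrite ffunE mulr_suml mulr_sumr.
  by apply: eq_bigr => T _; rewrite exprD -!mulrA.
rewrite [RHS](exchange_big_dep (fun S : {set 'I_n} => S \subset U)) /=; last first.
  by move=> W S WU SW; apply: subset_trans WU.
apply: eq_bigr => S SU.
rewrite [RHS](reindex_onto (fun T => S :|: T) (fun W => W :\: S)) /=; last first.
  by move=> W /andP[_ SW]; rewrite setDE setUIr setUCr setIT; apply/setUidPr.
apply: eq_big => T.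
  rewrite subUset SU subsetUl andbT setDUl setDv set0U subsetD.
  by congr (_ && _); apply/setDidPl/eqP.
rewrite subsetD => /andP[TU dTS].
have TE : (S :|: T) :\: S = T.
  by rewrite setDUl setDv set0U; apply/setDidPl.
rewrite TE setDDl; congr (_ * _); congr (_ ^+ _).
have TsD : T \subset U :\: S by rewrite subsetD TU.
rewrite (shuffleDr S TsD) (shuffleDl _ (subsetUl S T)) TE setDDl.
by rewrite -addnA addnC -!addnA; congr addn; rewrite addnC.
Qed.

Fact ext_mul1l : left_id ext_one ext_mul.
Proof.
move=> f; apply: extP => U; rewrite ffunE (bigD1 set0) ?sub0set //= ffunE eqxx.
rewrite shuffle0l expr0 !mul1r setD0 big1 ?addr0 // => S /andP[_ /negPf S0].
by rewrite ffunE S0 mul0r mulr0.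
Qed.

Fact ext_mul1r : right_id ext_one ext_mul.
Proof.
move=> f; apply: extP => U; rewrite ffunE (bigD1 U) //= setDv ffunE eqxx.
rewrite shuffle0r expr0 mul1r mulr1 big1 ?addr0 // => S /andP[SU nSU].
rewrite [ext_one _]ffunE setD_eq0; case: (boolP (U \subset S)) => [US|_].
  by rewrite eqEsubset SU US in nSU.
by rewrite !mulr0.
Qed.

Fact ext_mulDl : left_distributive ext_mul +%R.
Proof.
move=> f g h; apply: extP => U; rewrite extD !ffunE -big_split /=.
by apply: eq_bigr => S _; rewrite extD mulrDl mulrDr.
Qed.

Fact ext_mulDr : right_distributive ext_mul +%R.
Proof.
move=> f g h; apply: extP => U; rewrite extD !ffunE -big_split /=.
by apply: eq_bigr => S _; rewrite extD !mulrDr.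
Qed.

Fact ext_oner_neq0 : ext_one != 0.
Proof.
apply/eqP => /(congr1 (fun f : ext R n => f set0)); rewrite !ffunE eqxx.
by apply/eqP; rewrite oner_eq0.
Qed.

HB.instance Definition _ := GRing.Zmodule_isNzRing.Build (ext R n)
  ext_mulA ext_mul1l ext_mul1r ext_mulDl ext_mulDr ext_oner_neq0.

Lemma extM f g U : (f * g) U = \sum_(S : {set 'I_n} | S \subset U)
  (-1) ^+ shuffle S (U :\: S) * (f S * g (U :\: S)).
Proof. by rewrite ffunE. Qed.

Definition ext_monom (c : R) S : ext R n :=
  [ffun U : {set 'I_n} => if U == S then c else 0].

Definition ext_const (c : R) : ext R n := ext_monom c set0.

Definition xi k : ext R n := ext_monom 1 [set k].

Lemma ext_monomM (a b : R) S T : ext_monom a S * ext_monom b T =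
  if [disjoint S & T] then ext_monom ((-1) ^+ shuffle S T * (a * b)) (S :|: T)
  else 0.
Proof.
apply: extP => U; rewrite extM.
case: (boolP (S \subset U)) => SU; last first.
  rewrite big1 => [|V VU].
    case: ifP => _; rewrite ffunE //; case: eqP => // UE.
    by rewrite UE subsetUl in SU.
  rewrite ffunE; case: eqP => [VS|_]; last by rewrite mul0r mulr0.
  by rewrite -VS VU in SU.
rewrite (bigD1 S) //= big1 ?addr0 => [|V /andP[_ /negPf VS]]; last first.
  by rewrite ffunE VS mul0r mulr0.
rewrite !ffunE eqxx; case: (eqVneq (U :\: S) T) => [<-|UST].
  have -> : [disjoint S & U :\: S].
    by rewrite -setI_eq0 setIDA setIC -setIDA setDv setI0.
  by rewrite ffunE setDE setUIr setUCr setIT (setUidPr SU) eqxx.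
rewrite !mulr0; case: ifP => [dST|_]; rewrite ffunE //.
case: eqP => // UE; case/eqP: UST; rewrite UE setDUl setDv set0U.
by apply/setDidPl; rewrite disjoint_sym.
Qed.

Lemma ext_constM (c : R) f U : (ext_const c * f) U = c * f U.
Proof.
rewrite extM (bigD1 set0) ?sub0set //= ffunE eqxx shuffle0l mul1r setD0.
by rewrite big1 ?addr0 // => S /andP[_ /negPf S0]; rewrite ffunE S0 mul0r mulr0.
Qed.

Lemma ext_const_comm (c : R) f : ext_const c * f = f * ext_const c.
Proof.
apply: extP => U; rewrite ext_constM extM (bigD1 U) //= setDv ffunE eqxx.
rewrite shuffle0r mul1r mulrC big1 ?addr0 // => S /andP[SU nSU].
rewrite [ext_const c _]ffunE setD_eq0; case: ifP => [US|_]; last by rewrite !mulr0.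
by rewrite eqEsubset SU US in nSU.
Qed.

Lemma xi_sqr k : xi k * xi k = 0.
Proof. by rewrite ext_monomM -setI_eq0 setIid -cards_eq0 cards1. Qed.

Lemma xi_anticomm j k : xi j * xi k = - (xi k * xi j).
Proof.
have [->|jk] := eqVneq j k; first by rewrite xi_sqr oppr0.
rewrite !ext_monomM !disjoints1 !inE [k == j]eq_sym jk mulr1 setUC.
apply: extP => U; rewrite !ffunE; case: ifP => _; rewrite ?oppr0 //.
rewrite !mulr1 /shuffle !big_set1.
by have := jk; rewrite -val_eqE /=; case: ltngtP => //; rewrite opprK.
Qed.

Lemma ext_decomp f :
  f = \sum_(S : {set 'I_n}) ext_const (f S) * \prod_(k <- enum S) xi k.
Proof.
suff xiE S : \prod_(k <- enum S) xi k = ext_monom 1 S.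
  apply: extP => U; rewrite sum_ffunE (bigD1 U) //= xiE ext_constM ffunE eqxx.
  rewrite mulr1 big1 ?addr0 // => S /negPf SU.
  by rewrite xiE ext_constM ffunE eq_sym SU mulr0.
have {2}-> : S = [set k in enum S] by apply/setP => k; rewrite inE mem_enum.
have : sorted (fun i j : 'I_n => i < j)%N (enum S).
  rewrite {1}/enum_mem -enumT; apply: sorted_filter.
    by move=> j i k; apply: ltn_trans.
  by have := iota_ltn_sorted 0 n; rewrite -val_enum_ord sorted_map.
elim: (enum S) => [|k s IHs] ks.
  rewrite big_nil; apply: extP => U; rewrite !ffunE.
  have -> : [set k in [::]] = set0 :> {set 'I_n} by apply/setP => k; rewrite !inE.
  by case: eqP.
have lt_k : all (fun j : 'I_n => k < j)%N s.
  by apply: order_path_min ks => ? ? ?; apply: ltn_trans.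
rewrite big_cons IHs ?(path_sorted ks) // ext_monomM disjoints1 inE.
have -> : k \notin s by apply/negP => /(allP lt_k); rewrite ltnn.
rewrite set_cons /shuffle big_set1 big1 ?mulr1 // => j; rewrite inE.
by move/(allP lt_k); case: ltngtP.
Qed.

End ExtRing.

Section Koszul.
Variables (R : comNzRingType) (n : nat) (P : 'I_n -> R).
Implicit Types (f g : ext R n) (S T U : {set 'I_n}) (k : 'I_n).

(* The coefficient at T collects, for each k outside T, the contraction of
   xi_(T + k) along xi_k; see koszul_leibniz, koszul_const, koszul_xi. *)
Definition koszul f : ext R n :=
  [ffun T : {set 'I_n} => \sum_(k | k \notin T)
     (-1) ^+ shuffle [set k] T * (P k * f (k |: T))].

Definition parity f : ext R n := [ffun S : {set 'I_n} => (-1) ^+ #|S| * f S].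

Fact koszul_is_zmod_morphism : zmod_morphism koszul.
Proof.
move=> f g; apply: extP => T; rewrite !ffunE -sumrB.
by apply: eq_bigr => k _; rewrite !ffunE -!mulrBr.
Qed.

HB.instance Definition _ := GRing.isZmodMorphism.Build (ext R n) (ext R n)
  koszul koszul_is_zmod_morphism.

Lemma koszul_const (c : R) : koszul (ext_const n c) = 0.
Proof.
apply: extP => T; rewrite !ffunE big1 // => k _; rewrite ffunE.
by rewrite setU_eq0 -cards_eq0 cards1 !mulr0.
Qed.

Lemma koszul_xi k : koszul (xi R k) = ext_const n (P k).
Proof.
apply: extP => T; rewrite !ffunE; case: eqP => [->|/eqP T0].
  rewrite (bigD1 k) ?inE //= setU0 ffunE eqxx shuffle0r mul1r mulr1.
  rewrite big1 ?addr0 // => j /andP[_ jk]; rewrite setU0 ffunE.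
  by rewrite (inj_eq set1_inj) (negPf jk) !mulr0.
rewrite big1 // => j jT; rewrite ffunE; case: eqP => [E|_]; last by rewrite !mulr0.
have := cardsU1 j T; rewrite E cards1 jT => -[] /esym/eqP.
by rewrite cards_eq0 (negPf T0).
Qed.

Lemma big_subsetU1_out k T (F : {set 'I_n} -> R) : k \notin T ->
  \sum_(S : {set 'I_n} | (S \subset k |: T) && (k \notin S)) F S =
  \sum_(S : {set 'I_n} | S \subset T) F S.
Proof.
move=> kT; apply: eq_bigl => S; apply/andP/idP => [[SkT kS]|ST].
  by rewrite -(setU1K kT) subsetD1 SkT.
by split; [apply: subset_trans ST (subsetUr _ _) | apply: contra kT; apply: subsetP].
Qed.

Lemma big_subsetU1_in k T (F : {set 'I_n} -> R) : k \notin T ->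
  \sum_(S : {set 'I_n} | (S \subset k |: T) && (k \in S)) F S =
  \sum_(S : {set 'I_n} | S \subset T) F (k |: S).
Proof.
move=> kT; rewrite (reindex_onto (fun S => k |: S) (fun S => S :\ k)) /=; last first.
  by move=> S /andP[_ kS]; apply: setD1K.
apply: eq_bigl => S; rewrite setU11 andbT; apply/andP/idP.
  case=> skT /eqP <-; rewrite -(setU1K kT); exact: setSD.
move=> ST; split; first exact: setUS.
by rewrite setU1K //; apply: contra kT; apply: subsetP.
Qed.

Lemma koszul_leibniz f g :
  koszul (f * g) = koszul f * g + parity f * koszul g.
Proof.
apply: extP => T; rewrite extD !extM ffunE.
pose A k S := (-1) ^+ shuffle S (T :\: S) *
  ((-1) ^+ shuffle [set k] S * (P k * f (k |: S)) * g (T :\: S)).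
pose B k S := (-1) ^+ shuffle S (T :\: S) * ((-1) ^+ #|S| * f S *
  ((-1) ^+ shuffle [set k] (T :\: S) * (P k * g (k |: (T :\: S))))).
transitivity (\sum_k (\sum_(S : {set 'I_n} | (S \subset T) && (k \notin S)) A k S
  + \sum_(S : {set 'I_n} | (S \subset T) && (k \notin T :\: S)) B k S)); last first.
  rewrite big_split /=; congr (_ + _).
    rewrite (exchange_big_dep (fun S : {set 'I_n} => S \subset T)) /=;
      last by move=> k S _ /andP[].
    apply: eq_bigr => S ST; rewrite [koszul f _]ffunE mulr_suml mulr_sumr.
    by apply: eq_bigl => k; rewrite ST.
  rewrite (exchange_big_dep (fun S : {set 'I_n} => S \subset T)) /=;
    last by move=> k S _ /andP[].
  apply: eq_bigr => S ST; rewrite [koszul g _]ffunE [parity f _]ffunE !mulr_sumr.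
  by apply: eq_bigl => k; rewrite ST.
rewrite [RHS](bigID (fun k => k \notin T)) /= [X in _ + X]big1 ?addr0; last first.
  move=> k; rewrite negbK => kT.
  have kD : k \notin T :\ k by rewrite !inE eqxx.
  pose T0 := T :\ k; have TE : T = k |: T0 by rewrite setD1K.
  rewrite {1}TE big_subsetU1_out //.
  have -> : \sum_(S : {set 'I_n} | (S \subset T) && (k \notin T :\: S)) B k S =
            \sum_(S : {set 'I_n} | (S \subset k |: T0) && (k \in S)) B k S.
    by apply: eq_bigl => S; rewrite -TE !inE kT andbT negbK.
  rewrite big_subsetU1_in // -big_split big1 //= => S ST0.
  have kS : k \notin S by apply: contra kD; apply: subsetP.
  have D1 : T :\: (k |: S) = T0 :\: S by rewrite /T0 setDDl.
  have kV : k \notin T0 :\: S by rewrite !inE eqxx andbF.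
  have D2 : T :\: S = k |: (T0 :\: S).
    by rewrite TE setDUl; congr (_ :|: _); apply/setDidPl; rewrite disjoints1.
  rewrite /A /B D1 -D2; set V := T0 :\: S in D1 kV D2 *.
  rewrite D2 cardsU1 kS (shuffleDr S (subsetUl [set k] V)).
  rewrite (shuffleDl V (subsetUl [set k] S)) !setU1K // -(shuffle1C kS).
  rewrite add1n exprS !exprD.
  set a := _ ^+ shuffle S [set k]; set b := _ ^+ shuffle S V.
  set c := _ ^+ shuffle [set k] S; set e := _ ^+ shuffle [set k] V.
  have e2 : e * e = 1 by rewrite -expr2 sqrr_sign.
  transitivity ((1 - e * e) * (a * b * c * P k * f (k |: S) * g (k |: V))).
    by ring.
  by rewrite e2 subrr mul0r.
apply: eq_bigr => k kT; rewrite extM !mulr_sumr.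
rewrite (bigID (fun S => k \notin S)) /= addrC.
under eq_bigl do rewrite negbK.
rewrite big_subsetU1_in // big_subsetU1_out //; congr (_ + _).
  apply: eq_big => S.
    have [ST|//] := boolP (S \subset T).
    by rewrite (contra _ kT) // => /(subsetP ST).
  move=> ST; have kS : k \notin S by apply: contra kT; apply: subsetP.
  rewrite /A; have -> : (k |: T) :\: (k |: S) = T :\: S.
    apply/setP => j; rewrite !inE negb_or; case: eqP => //= ->.
    by rewrite (negPf kT) andbF.
  rewrite (shuffleDl _ (subsetUl [set k] S)) (shuffleDr [set k] ST) setU1K //.
  rewrite !exprD; set b := _ ^+ shuffle S _; set c := _ ^+ shuffle [set k] S.
  set e := _ ^+ shuffle [set k] (T :\: S).
  have e2 : e * e = 1 by rewrite -expr2 sqrr_sign.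
  transitivity (e * e * (b * (c * (P k * f (k |: S)) * g (T :\: S)))).
    by ring.
  by rewrite e2 mul1r.
apply: eq_big => S; first by rewrite inE negb_and kT orbT andbT.
move=> ST; have kS : k \notin S by apply: contra kT; apply: subsetP.
have kV : k \notin T :\: S by rewrite inE (negPf kT) andbF.
have D : (k |: T) :\: S = k |: (T :\: S).
  by rewrite setDUl; congr (_ :|: _); apply/setDidPl; rewrite disjoints1.
rewrite /B D (shuffleDr S (subsetUl [set k] (T :\: S))) setU1K //.
rewrite (shuffleDr [set k] ST) -(shuffle1C kS) !exprD.
by ring.
Qed.

Lemma koszulK f : koszul (koszul f) = 0.
Proof.
apply: extP => T; rewrite !ffunE.
pose F k (l : 'I_n) := if [&& k \notin T, l \notin T & l != k] then
  (-1) ^+ (shuffle [set k] T + shuffle [set l] T + (k < l)%N) *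
  (P k * P l * f (l |: (k |: T))) else 0.
have anti k (l : 'I_n) : (k < l)%N -> F l k = - F k l.
  move=> kl; rewrite /F andbCA [k == l]eq_sym; case: ifP => _; last by rewrite oppr0.
  rewrite kl ltnNge (ltnW kl) addn0 addn1 exprS mulN1r mulNr opprK.
  by rewrite setUCA [P l * _]mulrC [(shuffle [set l] T + _)%N]addnC.
transitivity (\sum_k \sum_(l < n) F k l).
  rewrite [RHS](bigID (fun k => k \in T)) /= [X in X + _]big1 ?add0r => [|k kT]; last first.
    by rewrite big1 // => l _; rewrite /F kT.
  apply: eq_bigr => k kT; rewrite ffunE mulrA mulr_sumr [LHS]big_mkcond /=.
  apply: eq_bigr => l _; rewrite /F kT !inE negb_or /= [(l != k) && _]andbC.
  case: ifP => // /andP[lT lk].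
  rewrite (shuffleDr [set l] (subsetUr [set k] T)).
  have -> : (k |: T) :\: T = [set k].
    by rewrite setDUl setDv setU0; apply/setDidPl; rewrite disjoints1.
  rewrite [shuffle [set l] [set k]]/shuffle !big_set1 !exprD.
  by ring.
pose G k (l : 'I_n) := if (k < l)%N then F k l else 0.
transitivity (\sum_k \sum_(l < n) (G k l - G l k)).
  apply: eq_bigr => k _; apply: eq_bigr => l _; rewrite /G.
  case: ltngtP => [_|lk|/val_inj kl]; rewrite ?subr0 ?sub0r //.
    by rewrite -anti.
  by rewrite /F kl eqxx !andbF.
under eq_bigr do rewrite big_split /= sumrN.
by rewrite big_split /= sumrN exchange_big subrr.
Qed.

End Koszul.

Definition Halg (n : nat) := ext {mpoly int[n]} n.

HB.instance Definition _ (n : nat) := GRing.NzRing.on (Halg n).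

Section Homology.
Variables (N n : nat).

(* Every index occurring in an N-tuple of sum k < n is itself less than n. *)
Definition dxi (k : 'I_n) : {mpoly int[n]} :=
  \sum_(i : {ffun 'I_N -> 'I_n} | (\sum_j i j == k)%N) \prod_j 'X_(i j).

Definition dN : Halg n -> Halg n := koszul dxi.

HB.instance Definition _ := GRing.isZmodMorphism.Build (Halg n) (Halg n) dN
  (koszul_is_zmod_morphism dxi).

Definition xgen (k : 'I_n) : Halg n := ext_const n 'X_k.

Lemma dN_xgen (k : 'I_n) : dN (xgen k) = 0.
Proof. exact: koszul_const. Qed.

Lemma dN_xi (k : 'I_n) : dN (xi {mpoly int[n]} k) =
  \sum_(i : {ffun 'I_N -> 'I_n} | (\sum_j i j == k)%N) \prod_j xgen (i j).
Proof.
have constM a b : ext_const n (a * b) = ext_const n a * ext_const n b :> Halg n.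
  by apply: extP => S; rewrite ext_constM !ffunE; case: ifP; rewrite ?mulr0.
have constD a b : ext_const n (a + b) = ext_const n a + ext_const n b :> Halg n.
  by apply: extP => S; rewrite !ffunE; case: ifP; rewrite ?addr0.
have const0 : ext_const n 0 = 0 :> Halg n.
  by apply: extP => S; rewrite !ffunE if_same.
have const1 : ext_const n 1 = 1 :> Halg n.
  by apply: extP => S; rewrite !ffunE; case: eqP.
rewrite [LHS]koszul_xi /dxi (big_morph _ constD const0).
by apply: eq_bigr => i _; rewrite (big_morph _ constM const1).
Qed.

Lemma dN_leibniz (f g : Halg n) : dN (f * g) = dN f * g + parity f * dN g.
Proof. exact: koszul_leibniz. Qed.

Lemma dNK (f : Halg n) : dN (dN f) = 0.
Proof. exact: koszulK. Qed.

Definition qdeg (m : 'X_{1.. n}) (S : {set 'I_n}) : nat :=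
  (\sum_k m k * (2 * k + 2) + \sum_(k in S) (2 * N + 2 * k))%N.

Definition tdeg (m : 'X_{1.. n}) (S : {set 'I_n}) : nat :=
  (\sum_k m k * (2 * k) + \sum_(k in S) (2 * k + 1))%N.

Definition homogeneous (a b : nat) (w : Halg n) : Prop :=
  forall (S : {set 'I_n}) (m : 'X_{1.. n}),
    m \in msupp (w S) -> qdeg m S = a /\ tdeg m S = b.

Lemma msupp_dxi (k : 'I_n) (m : 'X_{1.. n}) : m \in msupp (dxi k) ->
  (\sum_j m j = N)%N /\ (\sum_j m j * j = k)%N.
Proof.
move=> /msupp_sum_le /flattenP[s /mapP[i]].
rewrite mem_filter => /andP[/eqP <- _] -> ; rewrite mprodXE msuppX inE => /eqP ->.
have E j : (\sum_(l < N) U_(i l))%MM j = (\sum_(l < N) (i l == j))%N.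
  by rewrite mnm_sumE; apply: eq_bigr => l _; rewrite mnm1E.
split; last first.
  under eq_bigr do rewrite E big_distrl /=.
  rewrite exchange_big /=; apply: eq_bigr => l _.
  rewrite (bigD1 (i l)) //= eqxx mul1n big1 ?addn0 // => j /negPf.
  by rewrite eq_sym => ->.
under eq_bigr do rewrite E.
rewrite exchange_big /= -[RHS](card_ord N) -sum1_card; apply: eq_bigr => l _.
by rewrite (bigD1 (i l)) //= eqxx big1 // => j /negPf; rewrite eq_sym => ->.
Qed.

Lemma dN_homogeneous (a b : nat) (w : Halg n) :
  homogeneous a b.+1 w -> homogeneous a b (dN w).
Proof.
move=> hw T m; rewrite [dN w T]ffunE => /msupp_sum_le /flattenP[s /mapP[k]].
rewrite mem_filter => /andP[kT _] -> mP.
have {mP} : m \in msupp (dxi k * w (k |: T)).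
  move: mP; rewrite -signr_odd; case: odd; rewrite ?mul1r //.
  by rewrite expr1 mulN1r (perm_mem (msuppN _)).
move=> /msuppM_le/allpairsP[[m1 m2] /= [/msupp_dxi[d1 w1] /hw[q t] ->]].
move: q t; rewrite /qdeg /tdeg !big_setU1 //=.
have sumD (F : nat -> nat) : (\sum_j (m1 + m2)%MM j * F j =
    \sum_j m1 j * F j + \sum_j m2 j * F j)%N.
  by rewrite -big_split; apply: eq_bigr => j _; rewrite mnmDE mulnDl.
have s1 : (\sum_j m1 j * (2 * j) = 2 * k)%N.
  by rewrite -w1 big_distrr; apply: eq_bigr => j _ /=; rewrite mulnCA.
have s2 : (\sum_j m1 j * (2 * j + 2) = 2 * k + 2 * N)%N.
  rewrite -s1 -d1 big_distrr -big_split; apply: eq_bigr => j _ /=.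
  by rewrite mulnDr [(m1 j * 2)%N]mulnC.
rewrite (sumD (fun j => 2 * j + 2)%N) (sumD (fun j => 2 * j)%N) s1 s2.
move=> <- tE; split; first by rewrite addnA; congr addn; rewrite addnC [(2 * k + _)%N]addnC.
by apply/succn_inj; rewrite -tE addn1 addSn addnS addnA [(_ + 2 * k)%N]addnC.
Qed.

Definition is_cycle : {pred Halg n} := fun w => dN w == 0.

Fact is_cycle_zmod_closed : zmod_closed is_cycle.
Proof.
split=> [|v w]; rewrite !unfold_in ?raddf0 // => /eqP dv /eqP dw.
by rewrite raddfB /= dv dw subrr.
Qed.

HB.instance Definition _ :=
  GRing.isZmodClosed.Build (Halg n) is_cycle is_cycle_zmod_closed.

Record koszul_cycle := KoszulCycle { cycle_val :> Halg n; _ : cycle_val \in is_cycle }.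

HB.instance Definition _ := [isSub for cycle_val].
HB.instance Definition _ := [Choice of koszul_cycle by <:].
HB.instance Definition _ := [SubChoice_isSubZmodule of koszul_cycle by <:].

Definition is_boundary : {pred koszul_cycle} := fun z => `[< exists w, dN w = val z >].

Fact is_boundary_zmod_closed : zmod_closed is_boundary.
Proof.
split=> [|y z]; rewrite !unfold_in; first by apply/asboolP; exists 0; rewrite raddf0.
move=> /asboolP[v dv] /asboolP[w dw]; apply/asboolP; exists (v - w).
by rewrite raddfB /= dv dw -raddfB.
Qed.

HB.instance Definition _ :=
  GRing.isZmodClosed.Build koszul_cycle is_boundary is_boundary_zmod_closed.

Definition homology : zmodType := Quotient.quot is_boundary.

Definition homology_class (z : koszul_cycle) : homology := (\pi_homology z)%qT.

Fact homology_class_is_zmod_morphism : zmod_morphism homology_class.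
Proof. by move=> y z; apply: raddfB. Qed.

HB.instance Definition _ := GRing.isZmodMorphism.Build koszul_cycle homology
  homology_class homology_class_is_zmod_morphism.

Lemma homology_class_eq0 (z : koszul_cycle) :
  reflect (exists w, dN w = val z) (homology_class z == 0).
Proof.
rewrite -[0](raddf0 homology_class) -Quotient.idealrBE subr0 unfold_in.
exact: asboolP.
Qed.

(* The bidegree of a class is that of a homogeneous representing cycle.  If a
   multiple of the class vanishes, a chain bounding that multiple of the cycle
   has the same q-degree and t-degree one higher, cf. dN_homogeneous. *)
Definition in_bidegree (a b : nat) (h : homology) : Prop :=
  exists2 z : koszul_cycle, homogeneous a b (val z) & h = homology_class z.

End Homology.

(* Main.v *)
(* Let X(t) = x_0 + x_1 t + ... + x_(p-1) t^(p-1), so that d_N(xi_k) = [X^N]_k, and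
   let F = [X^(N+1)]_p.  Taking the coefficient of t^(p-1) in
   (X^(N+1))' = (N+1) X' X^N expresses p F as a boundary.  Were F itself equal
   to sum_(k < p) g_k [X^N]_k, apply partial derivatives with respect to
   x_(i_0), ..., x_(i_N), where i_0 + ... + i_N = p, and evaluate at 0: this
   gives a_(i_0) + ... + a_(i_N) = N+1, where a_i is the coefficient of x_i in
   g_(p-i) and a_0 = 0 because xi_p is absent.  Comparing the index tuples
   (0, ..., 0, m+1, p-m-1) and (0, ..., 0, 1, m, p-m-1) shows a_m = m a_1, hence
   p a_1 = N+1, impossible as p > N+1. *)
Require Import Defs.
From HB Require Import structures.
From mathcomp Require Import all_boot all_order all_algebra.
From mathcomp Require Import mpoly.
From mathcomp Require Import zify.

Import GRing.Theory Num.Theory.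

Local Open Scope ring_scope.

(** * Coefficients of powers of the generic polynomial [X(t)] *)

Definition gen_series (n : nat) : {poly {mpoly int[n]}} :=
  \sum_(k < n) 'X_k *: 'X^k.

Lemma coef_gen_series n (k : 'I_n) : (gen_series n)`_k = 'X_k.
Proof.
rewrite coef_sum (bigD1 k) //= coefZ coefXn eqxx mulr1 big1 ?addr0 // => j jk.
by rewrite coefZ coefXn eq_sym -[(_ == _ :> nat)]/(j == k) (negPf jk) mulr0.
Qed.

Lemma dxiE N n (k : 'I_n) : dxi N k = (gen_series n ^+ N)`_k.
Proof.
have -> : gen_series n ^+ N = \prod_(l < N) \sum_(i < n) 'X_i *: 'X^i.
  by rewrite prodr_const card_ord.
rewrite bigA_distr_bigA coef_sum /dxi big_mkcond; apply: eq_bigr => f _ /=.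
rewrite scaler_prod coefZ prodrXr coefXn eq_sym.
by case: eqP; rewrite ?mulr1 ?mulr0.
Qed.

(** These two sums fix the bidegree of the cycle [F], where [j = p] exceeds every index allowed in
    [dxi]. *)
Lemma msupp_gen_seriesX n M j (m : 'X_{1.. n}) :
  m \in msupp (gen_series n ^+ M)`_j ->
  (\sum_k m k = M)%N /\ (\sum_k m k * k = j)%N.
Proof.
elim: M j m => [|M IHM] j m.
  rewrite expr0 coef1; case: eqP => [->|_]; last by rewrite msupp0.
  rewrite msupp1 inE => /eqP ->.
  by split; rewrite big1 // => k _; rewrite mnm0E.
rewrite exprS coefM => /msupp_sum_le /flattenP[s /mapP[i _ ->]].
case: (ltnP i n) => [ltin|lein]; last first.
  rewrite coef_sum big1 ?mul0r ?msupp0 // => k _.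
  by rewrite coefZ coefXn gtn_eqF ?mulr0 // (leq_trans (ltn_ord k)).
rewrite (coef_gen_series _ (Ordinal ltin)).
move=> /msuppM_le/allpairsP[[m1 m2] /= [m1P /IHM[s2 w2] ->]].
move: m1P; rewrite msuppX inE => /eqP ->.
have sumD (F : nat -> nat) : (\sum_(k < n) (U_(Ordinal ltin) + m2)%MM k * F k =
    F i + \sum_(k < n) m2 k * F k)%N.
  under eq_bigr do rewrite mnmDE mulnDl.
  rewrite big_split /= (bigD1 (Ordinal ltin)) //= mnm1E eqxx mul1n.
  rewrite [X in (_ + X + _)%N]big1 ?addn0 // => k /negPf kE.
  by rewrite mnm1E eq_sym kE.
split; last by rewrite (sumD id) w2 subnKC // -ltnS.
have := sumD (fun=> 1%N); rewrite -!big_distrl /= !muln1.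
by rewrite s2.
Qed.

(** * Iterated partial derivatives at the origin *)

Section IteratedDerivation.
Variable n : nat.
Implicit Types (G H : {poly {mpoly int[n]}}) (i : 'I_n) (s : seq 'I_n).

(** The partial derivative in [x_i] with the series variable [t] held constant. *)
Definition polyder i G : {poly {mpoly int[n]}} := map_poly (mderiv i) G.

Lemma coef_polyder i G j : (polyder i G)`_j = (G`_j)^`M(i).
Proof. by rewrite coef_map_id0 // raddf0. Qed.

Lemma polyderD i G H : polyder i (G + H) = polyder i G + polyder i H.
Proof. by apply/polyP => j; rewrite coefD !coef_polyder coefD raddfD. Qed.

Lemma polyderM i G H : polyder i (G * H) = polyder i G * H + G * polyder i H.
Proof.
apply/polyP => j; rewrite coefD !coefM coef_polyder coefM raddf_sum -big_split.
by apply: eq_bigr => k _ /=; rewrite mderivM !coef_polyder.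
Qed.

Lemma polyder_Xn i k : polyder i 'X^k = 0.
Proof.
apply/polyP => j; rewrite coef_polyder coefXn coef0.
by case: eqP => _; rewrite ?raddf0 // -mpolyC1 mderivC.
Qed.

Lemma polyder_gen_series i : polyder i (gen_series n) = 'X^i.
Proof.
apply/polyP => j; rewrite coef_polyder coefXn coef_sum raddf_sum /=.
rewrite (bigD1 i) //= coefZ coefXn big1 ?addr0 => [|k ki].
  case: eqP => _; rewrite ?mulr0 ?raddf0 // mulr1 mderivX mnm1E eqxx scale1r.
  by rewrite -{1}[U_(i)%MM]add0m addmK mpolyX0.
rewrite coefZ coefXn; case: eqP => _; rewrite ?mulr0 ?raddf0 // mulr1.
by rewrite mderivX mnm1E (negPf ki) scale0r.
Qed.

Lemma polyder_gen_seriesX i M :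
  polyder i (gen_series n ^+ M.+1) = gen_series n ^+ M * 'X^i *+ M.+1.
Proof.
elim: M => [|M IHM]; first by rewrite expr1 expr0 mul1r polyder_gen_series.
rewrite exprS polyderM polyder_gen_series IHM mulrnAr mulrA -exprS.
by rewrite mulrC -mulrS.
Qed.

Definition der_at0 s G : {poly int} :=
  map_poly (meval (fun=> 0)) (foldl (fun H i => polyder i H) G s).

Lemma der_at0_nil G : der_at0 [::] G = map_poly (meval (fun=> 0)) G.
Proof. by []. Qed.

Lemma der_at0D s G H : der_at0 s (G + H) = der_at0 s G + der_at0 s H.
Proof.
elim: s G H => [|i s IHs] G H; first by rewrite !der_at0_nil raddfD.
by rewrite -[LHS]/(der_at0 s (polyder i (G + H))) polyderD IHs.
Qed.

Lemma der_at0MXn s k G : der_at0 s ('X^k * G) = 'X^k * der_at0 s G.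
Proof.
elim: s G => [|i s IHs] G.
  by rewrite !der_at0_nil rmorphM /= map_polyXn.
rewrite -[LHS]/(der_at0 s (polyder i ('X^k * G))).
by rewrite polyderM polyder_Xn mul0r add0r IHs.
Qed.

Lemma der_at0Mn s G k : der_at0 s (G *+ k) = der_at0 s G *+ k.
Proof.
elim: k => [|k IHk]; last by rewrite !mulrS der_at0D IHk.
by apply: (addrI (der_at0 s 0)); rewrite -der_at0D !mulr0n !addr0.
Qed.

(** Product rule: the derivative either hits the power, where it replaces one factor [X] by [t^i],
    or passes to [G]. *)
Lemma der_at0_cons i s M G :
  der_at0 (i :: s) (gen_series n ^+ M.+1 * G) =
  'X^i * der_at0 s (gen_series n ^+ M * G) *+ M.+1 +
  der_at0 s (gen_series n ^+ M.+1 * polyder i G).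
Proof.
rewrite -[LHS]/(der_at0 s (polyder i (_ * _))) polyderM der_at0D; congr (_ + _).
rewrite -der_at0MXn -der_at0Mn; congr der_at0.
by rewrite polyder_gen_seriesX mulrnAl mulrAC mulrC.
Qed.

(** Each derivative removes at most one factor [X], and a remaining one vanishes at the origin. *)
Lemma der_at0_lt s M G : (size s < M)%N -> der_at0 s (gen_series n ^+ M * G) = 0.
Proof.
elim: s M G => [|i s IHs] [|M] G //= sM.
  rewrite der_at0_nil rmorphM rmorphXn /=.
  suff -> : map_poly (meval (fun=> 0)) (gen_series n) = 0 by rewrite expr0n mul0r.
  rewrite raddf_sum big1 // => k _; apply/polyP => j.
  by rewrite coef_map coefZ /= mevalM mevalXU mul0r coef0.
by rewrite der_at0_cons !IHs ?mulr0 ?mul0rn ?addr0 // leqW.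
Qed.

(** Every derivative must consume its own factor [X]; there are [M!] ways to match them. *)
Lemma der_at0_eq s M G : size s = M ->
  der_at0 s (gen_series n ^+ M * G) =
  'X^(\sum_(i <- s) i) * der_at0 [::] G *+ M`!.
Proof.
elim: s M G => [|i s IHs] [|M] G //=.
  by rewrite expr0 big_nil !mul1r.
case=> sM; rewrite der_at0_cons IHs // der_at0_lt ?addr0 ?sM //.
by rewrite big_cons exprD factS mulnC mulrnA mulrnAr mulrA.
Qed.

(** Exactly one derivative, [r], is spare and falls on [G]; the others consume the [M] factors
    [X]. *)
Lemma der_at0_eqS s M G : size s = M.+1 ->
  der_at0 s (gen_series n ^+ M * G) =
  (\sum_(r <- s) 'X^(\sum_(i <- s) i - r) * der_at0 [:: r] G) *+ M`!.
Proof.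
elim: s M G => [|i s IHs] [|M] G //=.
  by case: s {IHs} => // _; rewrite expr0 !big_seq1 subnn !mul1r.
case=> sM; rewrite der_at0_cons IHs // (der_at0_eq s M.+1) //.
rewrite [in RHS]big_cons big_cons addKn mulrnDl addrC; congr (_ + _).
rewrite factS mulnC mulrnA mulrnAr mulr_sumr; congr (_ *+ _ *+ _).
apply: eq_big_seq => r rs; rewrite mulrA -exprD addnBA //.
by rewrite (big_rem r) //= leq_addr.
Qed.

End IteratedDerivation.

(** * [F] lies outside the ideal of the [[X^N]_k] *)

Lemma gen_seriesX_notin_ideal N p (g : 'I_p -> {mpoly int[p]}) :
  (2 <= N)%N -> (N.+1 < p)%N ->
  \sum_k dxi N k * g k <> (gen_series p ^+ N.+1)`_p.
Proof.
move=> N2 Np gE.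
(* The shift by [t^(p-k)] packs the whole combination into the single coefficient of [t^p] in
   [X^N G]. *)
pose G := \sum_k g k *: 'X^(p - k).
have {gE} GE : (gen_series p ^+ N * G)`_p = (gen_series p ^+ N.+1 * 1)`_p.
  rewrite mulr1 -gE mulr_sumr coef_sum; apply: eq_bigr => k _.
  rewrite -scalerAr coefZ coefMXn ltnNge leq_subr /= subKn; last exact: ltnW.
  by rewrite mulrC dxiE.
pose a r := (der_at0 p [:: r] G)`_r.
have aE (s : seq 'I_p) : size s = N.+1 -> (\sum_(i <- s) i = p)%N ->
    \sum_(r <- s) a r = N.+1%:R.
  move=> sN sp.
  (* Only the coefficients of [t^p] are known to agree; this suffices because [der_at0] acts
     coefficientwise in [t]. *)
  have derp (H H' : {poly {mpoly int[p]}}) : H`_p = H'`_p ->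
      (der_at0 p s H)`_p = (der_at0 p s H')`_p.
    rewrite /der_at0; elim: s {sN sp} H H' => [|i s IHs] H H' HE /=.
      by rewrite !coef_map HE.
    by apply: IHs; rewrite !coef_polyder HE.
  have := derp _ _ GE.
  rewrite der_at0_eqS // der_at0_eq // sp !coefMn coefXnM ltnn subnn.
  rewrite der_at0_nil coef_map coef1 /= rmorph1 coef_sum.
  have -> : \sum_(r <- s) ('X^(p - r) * der_at0 p [:: r] G)`_p = \sum_(r <- s) a r.
    apply: eq_bigr => r _; rewrite coefXnM ltnNge leq_subr subKn //.
    exact: ltnW.
  have fN0 : N`!%:R != 0 :> int by rewrite pnatr_eq0 -lt0n fact_gt0.
  by rewrite factS natrM -[_ *+ N`!]mulr_natr => /(mulIf fN0).
have p0 : (0 < p)%N by lia.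
have p1 : (1 < p)%N by lia.
pose i0 := Ordinal p0; pose i1 := Ordinal p1.
(* All exponents [p - k] are positive, so [G] has no constant term in [t]. *)
have a0 : a i0 = 0.
  rewrite /a coef_map coef_polyder /G coef_sum big1 ?raddf0 // => k _.
  by rewrite coefZ coefXn ltn_eqF ?subn_gt0 // mulr0.
have iter0 k (x : int) : iter k (+%R (a i0)) x = x.
  by elim: k => //= k ->; rewrite a0 add0r.
have iter00 k (x : nat) : iter k (addn i0) x = x by elim: k => //= k ->.
have pair (i j : 'I_p) : (i + j = p)%N -> a i + a j = N.+1%:R.
  move=> ij; rewrite -(aE (nseq N.-1 i0 ++ [:: i; j])).
  - by rewrite big_cat big_nseq /= iter0 !big_cons big_nil addr0 add0r.
  - by rewrite size_cat size_nseq /=; lia.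
  - by rewrite big_cat big_nseq /= iter00 !big_cons big_nil addn0.
(* Since [N >= 2], three free indices fit among the [N+1]; the rest are padded with 0. *)
have triple (i j k : 'I_p) : (i + j + k = p)%N -> a i + a j + a k = N.+1%:R.
  move=> ij; rewrite -(aE (nseq N.-2 i0 ++ [:: i; j; k])).
  - by rewrite big_cat big_nseq /= iter0 !big_cons big_nil addr0 add0r addrA.
  - by rewrite size_cat size_nseq /=; lia.
  - by rewrite big_cat big_nseq /= iter00 !big_cons big_nil addn0 add0n addnA.
have lin m (mp : (m < p)%N) : a (Ordinal mp) = a i1 *+ m.
  elim: m mp => [|m IHm] mp.
    by rewrite mulr0n -a0; congr a; apply: val_inj.
  have mp' : (m < p)%N by lia.
  have kp : (p - m.+1 < p)%N by lia.
  have := pair (Ordinal mp) (Ordinal kp) _; rewrite /= subnKC ?(ltnW mp) //.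
  move=> /(_ erefl).
  rewrite -(triple i1 (Ordinal mp') (Ordinal kp)) /= ?IHm; last by lia.
  by move=> /addIr ->; rewrite mulrS.
have pp : (p.-1 < p)%N by lia.
(* The pair [(1, p-1)] gives [p a_1 = N+1], so [p] would divide the smaller positive number
   [N+1]. *)
have := pair i1 (Ordinal pp); rewrite lin -mulrS prednK //= add1n prednK //.
move=> /(_ erefl) /(congr1 (fun x : int => (p %| x)%Z)).
rewrite -[a i1 *+ p]mulr_natr !natz /= (dvdz_mull _ (dvdzz _)) => /esym; rewrite dvdzE /=.
by move/dvdn_leq; lia.
Qed.

(** * Boundaries without odd generators, and the torsion class *)

Lemma dN_coef0 N n (w : Halg n) :
  dN N w set0 = \sum_k dxi N k * w [set k].
Proof.
rewrite ffunE; apply: eq_big => k; first by rewrite inE.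
by rewrite shuffle0r mul1r setU0.
Qed.

(** With [dN_coef0], this identifies the constants that are boundaries with the ideal generated by
    the [dxi N k]. *)
Lemma dN_sum_xi N n (c : 'I_n -> {mpoly int[n]}) :
  dN N (\sum_k ext_monom (c k) [set k]) = ext_const n (\sum_k dxi N k * c k).
Proof.
apply: extP => T; rewrite [RHS]ffunE; case: eqP => [->|/eqP T0].
  rewrite dN_coef0; apply: eq_bigr => k _; congr (_ * _).
  rewrite sum_ffunE (bigD1 k) //= ffunE eqxx big1 ?addr0 // => j jk.
  by rewrite ffunE (inj_eq set1_inj) eq_sym (negPf jk).
rewrite ffunE big1 // => k kT; rewrite sum_ffunE big1 ?mulr0 // => j _.
rewrite ffunE; case: eqP => // E; have := cardsU1 k T.
by rewrite E cards1 kT => -[] /esym/eqP; rewrite cards_eq0 (negPf T0).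
Qed.

Theorem theorem7 (N p : nat) :
  (2 <= N)%N -> prime p -> (N.+1 < p)%N ->
  exists h : homology N p,
    [/\ in_bidegree (2 * p + 2 * N + 2) (2 * p) h, h != 0 & h *+ p = 0].
Proof.
move=> N2 _ Np; pose F := (gen_series p ^+ N.+1)`_p.
have cycF : (ext_const p F : Halg p) \in @is_cycle N p.
  by rewrite unfold_in /dN koszul_const.
pose z := KoszulCycle cycF.
exists (homology_class z); split.
- exists z => // S m; rewrite /z /= ffunE; case: eqP => [->|_]; last first.
    by rewrite msupp0.
  move=> /msupp_gen_seriesX[mN mp].
  rewrite /qdeg /tdeg !big_set0 !addn0.
  have mp2 : (\sum_k m k * (2 * k) = 2 * p)%N.
    by rewrite -[in RHS]mp big_distrr; apply: eq_bigr => k _ /=; rewrite mulnCA.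
  split=> //; under eq_bigr do rewrite mulnDr.
  by rewrite big_split /= mp2 -big_distrl /= mN; lia.
- apply/homology_class_eq0 => -[w /(congr1 (fun f : Halg p => f set0))].
  rewrite dN_coef0 ffunE eqxx.
  exact: gen_seriesX_notin_ideal.
apply/eqP; rewrite -raddfMn; apply/homology_class_eq0.
(* These are the coefficients of [(N+1) X'] complementary to [[X^N]_k] in degree [p-1]; the
   resulting chain has t-degree [2p+1], one above the class. *)
pose c (k : 'I_p) := (gen_series p)^`()`_(p.-1 - k) *+ N.+1.
exists (\sum_k ext_monom (c k) [set k]); rewrite dN_sum_xi raddfMn /=.
have -> : \sum_k dxi N k * c k = F *+ p.
  have p0 : (0 < p)%N by lia.
  have -> : F *+ p = (gen_series p ^+ N.+1)^`()`_p.-1.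
    by rewrite coef_deriv prednK.
  rewrite deriv_exp coefMn mulrC coefM prednK // -sumrMnl.
  by apply: eq_bigr => k _; rewrite mulrnAr dxiE.
by apply: extP => S; rewrite ffunMnE !ffunE; case: eqP; rewrite ?mul0rn.
Qed.
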